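(* Let $\mathscr{C}$ be a nowhere dense class of graphs and let $k,r\in\mathbb{N}$. Then the class $\eta^k_r(\mathscr{C})=\{\eta^k_r(G):G\in\mathscr{C}\}$ has the weak $p$-Helly property for some $p\in\mathbb{N}$ depending on $k$, $r$ and $\mathscr{C}$; that is, every graph in $\eta^k_r(\mathscr{C})$ has the weak $p$-Helly property.
   Context: For $\bar x=(x_1,\dots,x_k)$, $\eta^k_r(\bar x;y)=\bigwedge_{1\le i<j\le k}\big(\mathrm{dist}(x_i,y)+\mathrm{dist}(x_j,y)>r\big)$. For a graph $G$ with vertex set $V$, $\eta^k_r(G)$ is the bipartite graph with left part $V^k$ (tuples $\bar a$), right part $V$, with $\bar a$ adjacent to $b$ iff $\eta^k_r(\bar a;b)$ holds in $G$. A bipartite graph $(L,R,E)$ has the weak $p$-Helly property if either some $a\in L$ is adjacent to all vertices of $R$, or there is a set $P\subseteq R$ with $|P|\le p$ such that no $a\in L$ is adjacent to all vertices of $P$. A graph class $\mathscr{C}$ is nowhere dense if for every $r\in\mathbb{N}$ there is $t$ such that no graph in $\mathscr{C}$ contains a subgraph from which $K_t$ can be obtained by contracting pairwise disjoint connected subgraphs of radius at most $r$. *)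

(* Defs.v *)
From mathcomp Require Import all_boot.

Set Implicit Arguments.
Unset Strict Implicit.
Unset Printing Implicit Defensive.

Record sgraph := SGraph {
  vertex :> finType;
  adj : rel vertex;
  adj_sym : symmetric adj;
  adj_irrefl : irreflexive adj
}.

(* A graph class; it need not be closed under isomorphism. *)
Definition graph_class := sgraph -> Prop.

(** Distances take values in the naturals with infinity, where [None] stands
    for infinity, the distance between vertices in different components. *)

Definition enat := option nat.

Definition eadd (m n : enat) : enat :=
  if m is Some m' then (if n is Some n' then Some (m' + n') else None)
  else None.

Definition egt (n : enat) (r : nat) : bool := if n is Some n' then r < n' else true.

Definition walk (G : sgraph) (x y : G) (n : nat) : bool :=
  [exists p : n.-tuple G, path (@adj G) x p && (y == last x p)].

Lemma walkP (G : sgraph) (x y : G) :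
  reflect (exists n, walk x y n) (connect (@adj G) x y).
Proof.
apply: (iffP connectP) => [[p xp ->]|[n /existsP[p /andP[xp /eqP ->]]]].
  by exists (size p); apply/existsP; exists (in_tuple p); rewrite /= xp eqxx.
by exists p.
Qed.

Definition dist (G : sgraph) (x y : G) : enat :=
  if decP (walkP x y) is left xy then Some (ex_minn xy) else None.

Definition connected (G : sgraph) : Prop :=
  forall x y : G, connect (@adj G) x y.

(* The empty graph has no radius, so it is excluded here. *)
Definition radius_le (r : nat) (G : sgraph) : Prop :=
  exists c : G, forall v : G, ~~ egt (dist c v) r.

(* Not necessarily induced. *)
Record subgraph (G : sgraph) := Subgraph {
  sub_vset : {set G};
  sub_adj : rel G;
  sub_adj_sym : symmetric sub_adj;
  sub_adj_adj : forall x y, sub_adj x y -> adj x y;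
  sub_adj_vset : forall x y, sub_adj x y -> x \in sub_vset
}.

Section SubgraphGraph.
Variables (G : sgraph) (H : subgraph G).

Let sub_rel : rel {x : G | x \in sub_vset H} :=
  fun x y => sub_adj H (val x) (val y).

Lemma sub_rel_sym : symmetric sub_rel.
Proof. by move=> x y; apply: sub_adj_sym. Qed.

Lemma sub_rel_irrefl : irreflexive sub_rel.
Proof.
by move=> x; apply/negP => /(@sub_adj_adj _ H); rewrite adj_irrefl.
Qed.

Definition graph_of_subgraph : sgraph := SGraph sub_rel_sym sub_rel_irrefl.

End SubgraphGraph.

Coercion graph_of_subgraph : subgraph >-> sgraph.

(* [K] is, up to isomorphism, the simple graph obtained from [H] by contracting
   each [S i] to a single vertex; [q] is the quotient map.  Vertices outside all
   the [S i] are left uncontracted. *)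
Definition is_contraction (H : sgraph) (m : nat) (S : 'I_m -> subgraph H)
    (K : sgraph) : Prop :=
  exists q : H -> K,
    [/\ forall a : K, exists u : H, q u = a,
        forall u v : H, q u = q v <->
          u = v \/ exists i, u \in sub_vset (S i) /\ v \in sub_vset (S i)
      & forall a b : K, adj a b <->
          a <> b /\ exists u v : H, [/\ q u = a, q v = b & adj u v]].

Definition shallow_minor (r : nat) (K G : sgraph) : Prop :=
  exists (H : subgraph G) (m : nat) (S : 'I_m -> subgraph H),
    [/\ forall i j, i != j -> [disjoint sub_vset (S i) & sub_vset (S j)],
        forall i, connected (S i) /\ radius_le r (S i)
      & is_contraction S K].

Lemma complete_sym (t : nat) : symmetric (fun i j : 'I_t => i != j).
Proof. by move=> i j; rewrite eq_sym. Qed.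

Lemma complete_irrefl (t : nat) : irreflexive (fun i j : 'I_t => i != j).
Proof. by move=> i; rewrite eqxx. Qed.

Definition complete (t : nat) : sgraph :=
  SGraph (@complete_sym t) (@complete_irrefl t).

Definition nowhere_dense (C : graph_class) : Prop :=
  forall r : nat, exists t : nat,
    forall G : sgraph, C G -> ~ shallow_minor r (complete t) G.

Record bigraph := BiGraph {
  left_part : finType;
  right_part : finType;
  biadj : left_part -> right_part -> bool
}.

Definition eta (k r : nat) (G : sgraph) (x : k.-tuple G) (y : G) : bool :=
  [forall i : 'I_k, forall j : 'I_k,
    (i < j) ==> egt (eadd (dist (tnth x i) y) (dist (tnth x j) y)) r].

Definition eta_graph (k r : nat) (G : sgraph) : bigraph :=
  BiGraph (@eta k r G).

Definition eta_class (k r : nat) (C : graph_class) : bigraph -> Prop :=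
  fun B => exists2 G : sgraph, C G & B = eta_graph k r G.

Definition weak_helly (p : nat) (B : bigraph) : Prop :=
  (exists a : left_part B, forall b : right_part B, biadj a b) \/
  (exists P : {set right_part B},
     #|P| <= p /\
     ~ exists a : left_part B, forall b : right_part B, b \in P -> biadj a b).

Definition class_weak_helly (p : nat) (D : bigraph -> Prop) : Prop :=
  forall B : bigraph, D B -> weak_helly p B.

(* Main.v *)
Require Import Defs.
From mathcomp Require Import all_boot.
From Stdlib Require Import Classical.

Set Implicit Arguments.
Unset Strict Implicit.
Unset Printing Implicit Defensive.

(** The proof is a finitary version of the following model-theoretic argument.
    If no finite set [P] works, then in an elementary extension of [G] some
    tuple [x] has no short connection through [G]; since the elements of [x] are
    independent over [G], taking the [j]-th entry of the [j]-th term of a Morley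
    sequence of [x] gives a tuple that is adjacent to every vertex.

    Here [G] is replaced by a chain [P 0], [P 1], ... of vertex sets of bounded
    size: [P i.+1] contains a tuple of each distance type over [P i], and, for
    each [Z] included in [P i], a set of small radius that avoids [P i] and is
    adjacent to all of [Z] (a fan), if there is one.  A level [i] is bad for [v]
    if some short path from [v] to [P i.+1] avoids [P i].  A vertex with many
    bad levels yields [t] disjoint fans over the same [t] vertices, hence a
    shallow minor [K_t].  So if [x] is adjacent to all of a late [P L], then
    there are [k] levels that are good for all its entries; replacing the [j]-th
    entry by that of a tuple of the same type found at the [j]-th good level
    gives a tuple adjacent to all vertices, because a short path between two of
    its entries would pass through [P L] and connect two entries of [x]. *)

(** * Bounded distance and short paths *)

Definition within (G : sgraph) n (x y : G) := ~~ egt (dist x y) n.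

Lemma withinP (G : sgraph) n (x y : G) :
  reflect (exists p, [/\ path (@adj G) x p, last x p = y & size p <= n])
    (within n x y).
Proof.
rewrite /within /dist; case: decP => [xy|nxy] /=.
  rewrite -leqNgt; apply: (iffP idP); case: ex_minnP => m /existsP[p /andP[xp /eqP yp]] min_m.
    by move=> mn; exists p; rewrite size_tuple.
  case=> q [xq yq qn]; apply: leq_trans qn; apply: min_m; apply/existsP.
  by exists (in_tuple q); rewrite /= xq yq eqxx.
constructor => -[p [xp yp _]]; apply: nxy; exists (size p).
by apply/existsP; exists (in_tuple p); rewrite /= xp yp eqxx.
Qed.

Lemma within_sym (G : sgraph) n (x y : G) : within n x y = within n y x.
Proof.
wlog suff: x y / within n x y -> within n y x.
  by move=> IH; apply/idP/idP; apply: IH.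
case/withinP=> p [xp <- pn]; apply/withinP; exists (rev (belast x p)).
split; last by rewrite size_rev size_belast.
  rewrite rev_path; move: xp; rewrite (eq_path (e' := fun a b => adj b a)) //.
  by move=> a b; apply: adj_sym.
by case: p {xp pn} => //= a p; rewrite rev_cons last_rcons.
Qed.

Lemma within_trans (G : sgraph) m n (y x z : G) :
  within m x y -> within n y z -> within (m + n) x z.
Proof.
case/withinP=> p [xp <- pm] /withinP[q [yq <- qn]]; apply/withinP.
by exists (p ++ q); rewrite cat_path last_cat size_cat xp yq leq_add.
Qed.

(** A violating pair has finite distances; [d] can be taken to be the first, which leaves [r - d]
    for the second. *)
Lemma etaPn (G : sgraph) k r (x : k.-tuple G) (y : G) :
  reflect (exists i j : 'I_k, exists2 d, i < j & [/\ d <= r,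
             within d (tnth x i) y & within (r - d) (tnth x j) y])
    (~~ eta r x y).
Proof.
apply: (iffP idP) => [|[i [j [d ij [dr xi xj]]]]].
  rewrite negb_forall => /existsP[i]; rewrite negb_forall => /existsP[j].
  rewrite negb_imply => /andP[ij].
  case Ei: (dist _ _) => [m|] //; case Ej: (dist _ _) => [n|] //=.
  rewrite -leqNgt => mn; exists i, j, m => //.
  by rewrite /within Ei Ej /= -!leqNgt leqnn leq_subRL ?mn (leq_trans _ mn) ?leq_addr.
rewrite negb_forall; apply/existsP; exists i; rewrite negb_forall; apply/existsP.
exists j; rewrite ij /=; move: xi xj; rewrite /within.
case: (dist _ _) => [m|] //; case: (dist _ _) => [n|] //=; rewrite -!leqNgt => md nd.
by rewrite -(subnKC dr) leq_add.
Qed.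

(** * Shallow complete minors from branch sets *)

(** The paths stay inside [F], so [r] bounds the radius of the subgraph induced on [F]. *)
Definition centered (G : sgraph) r (c : G) (F : {set G}) :=
  c \in F /\ forall v, v \in F -> exists p,
    [/\ path (@adj G) c p, last c p = v, size p <= r & {subset p <= F}].

Section Minor.
Variables (G : sgraph) (r t : nat) (B : 'I_t -> {set G}).
Hypothesis Bdisj : forall i j, i != j -> [disjoint B i & B j].
Hypothesis Bcent : forall i, exists c, centered r c (B i).
Hypothesis Badj : forall i j, i != j ->
  exists u v, [/\ u \in B i, v \in B j & adj u v].

Let V := \bigcup_i B i.
Let hadj : rel G := fun x y => [&& x \in V, y \in V & adj x y].

Fact hadj_sym : symmetric hadj.
Proof. by move=> x y; rewrite /hadj adj_sym andbCA. Qed.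

Fact hadj_adj x y : hadj x y -> adj x y.
Proof. by case/and3P. Qed.

Fact hadj_vset x y : hadj x y -> x \in V.
Proof. by case/and3P. Qed.

Let H : subgraph G := Subgraph hadj_sym hadj_adj hadj_vset.
Let W i : {set H} := [set v | val v \in B i].
Let sadj i : rel H := fun x y => [&& x \in W i, y \in W i & adj x y].

Fact sadj_sym i : symmetric (sadj i).
Proof. by move=> x y; rewrite /sadj adj_sym andbCA. Qed.

Fact sadj_adj i x y : sadj i x y -> adj x y.
Proof. by case/and3P. Qed.

Fact sadj_vset i x y : sadj i x y -> x \in W i.
Proof. by case/and3P. Qed.

Let S i : subgraph H := Subgraph (@sadj_sym i) (@sadj_adj i) (@sadj_vset i).

Let mkH (x : G) i (Bx : x \in B i) : H.
Proof. by exists x; apply/bigcupP; exists i. Defined.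

Let mkS (x : G) i (Bx : x \in B i) : S i.
Proof. by exists (mkH Bx); rewrite inE. Defined.

Fact lift_path i (c : S i) p :
    path (@adj G) (val (val c)) p -> {subset p <= B i} ->
  exists q : seq (S i), path (@adj (S i)) c q /\
    [seq val (val u) | u <- q] = p.
Proof.
elim: p c => [|y p IH] c /=; first by exists [::].
case/andP=> cy yp sub.
have By : y \in B i by apply: sub; rewrite mem_head.
have [|q [cq qp]] := IH (mkS By) yp.
  by move=> u pu; apply: sub; rewrite inE pu orbT.
exists (mkS By :: q); split; last by rewrite /= qp.
rewrite /= cq andbT; apply/and3P; split; first exact: (valP c).
  exact: (valP (mkS By)).
apply/and3P; split=> //; first exact: (valP (val c)).
exact: (valP (mkH By)).
Qed.

Fact S_centered i : exists c : S i, forall v : S i, within r c v.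
Proof.
have [c [cB cent]] := Bcent i; exists (mkS cB) => v.
have Bv : val (val v) \in B i by have:= valP v; rewrite inE.
have [p [cp pv pr sub]] := cent _ Bv.
have [q [cq qp]] := lift_path (c := mkS cB) cp sub.
apply/withinP; exists q; split=> //; last by rewrite -(size_map (fun u => val (val u))) qp.
apply: val_inj; apply: val_inj; rewrite -pv -qp.
by rewrite (last_map (fun u : S i => val (val u)) q (mkS cB)).
Qed.

(** As [H] is induced on the union of the branch sets, the quotient map can send each vertex to the
    index of its branch set. *)
Lemma minor_of_branch_sets : shallow_minor r (complete t) G.
Proof.
have inH (v : H) : {i | val v \in B i}.
  by apply: sigW; have /bigcupP[i _ vi] := valP v; exists i.
pose q v := sval (inH v).
have qB v : val v \in B (q v) := svalP (inH v).
have qE v i : val v \in B i -> q v = i.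
  move=> vi; apply: contraTeq vi => /Bdisj /disjoint_setI0 /setP/(_ (val v)).
  by rewrite !inE qB /= => ->.
exists H, t, S; split=> [i j ij|i|].
- rewrite disjoint_subset; apply/subsetP=> v; rewrite !inE => vi.
  by apply: contra_neqN ij => vj; rewrite -(qE _ _ vi) (qE _ _ vj).
- have [c cS] := S_centered i; split; last by exists c.
  have conn v : connect (@adj (S i)) c v.
    by have /withinP[p [cp <- _]] := cS v; apply/connectP; exists p.
  move=> x y; apply: connect_trans (conn y).
  by rewrite sym_connect_sym //; apply: adj_sym.
exists q; split=> [i|u v|i j].
- have [c [cB _]] := Bcent i; exists (mkH cB); exact: qE.
- split=> [uv|[->//|[i [ui vi]]]].
    by right; exists (q u); rewrite !inE qB uv qB.
  by move: ui vi; rewrite !inE => /qE-> /qE->.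
split=> [ij|[/eqP ij _] //].
have [u [v [ui vj uv]]] := Badj ij; split; first exact/eqP.
exists (mkH ui), (mkH vj); split; [exact: qE|exact: qE|].
by apply/and3P; split=> //; apply/bigcupP; [exists i|exists j].
Qed.

End Minor.

(** * Fans, and counting along finite sequences *)

Definition fan (G : sgraph) r (Z F : {set G}) :=
  (exists c, centered r c F) /\
  forall z, z \in Z -> exists2 v, v \in F & adj v z.

Lemma seq_choice (I : eqType) (T : Type) (t0 : T) (s : seq I) (Q : I -> T -> Prop) :
  (forall i, i \in s -> exists u, Q i u) ->
  exists f : I -> T, forall i, i \in s -> Q i (f i).
Proof.
elim: s => [|i s IH] Qs; first by exists (fun=> t0).
have [j js|f fP] := IH; first by apply: Qs; rewrite inE js orbT.
have [|u Qu] := Qs i; first exact: mem_head.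
exists (fun j => if j == i then u else f j) => j; rewrite inE.
by case: eqP => [->|_] //= /fP.
Qed.

Lemma pigeonhole_count (T : finType) (I : eqType) (f : I -> T) (s : seq I) b :
  (forall z, count (fun i => f i == z) s <= b) ->
  size s <= #|[set z | z \in map f s]| * b.
Proof.
move=> small; set Z := [set _ | _].
have -> : size s = \sum_(z in Z) count (fun i => f i == z) s.
  under eq_bigr => z _ do rewrite -sum1_count big_mkcond.
  rewrite exchange_big -sum1_size /=; apply: eq_big_seq => i si.
  rewrite (bigD1 (f i)) ?inE ?map_f //= eqxx big1 // => z /andP[_ /negPf].
  by rewrite eq_sym => ->.
by rewrite -sum_nat_const; apply: leq_sum.
Qed.

(** Each window of length [t] with a strict drop uses up one of [b] units, so one of the first
    [b.+1] windows has none. *)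
Lemma antitone_plateau (h : nat -> nat) t a b :
  (forall i j, i <= j -> h j <= h i) -> h a <= b ->
  exists2 c, c <= b & h (a + c * t) = h (a + c.+1 * t).
Proof.
move=> anti; elim: b a => [|b IH] a hb.
  have h0 : h a = 0 by apply/eqP; rewrite -leqn0.
  by exists 0; rewrite // addn0 h0; apply/esym/eqP; rewrite -leqn0 -h0 anti ?leq_addr.
have [eq_h|ne_h] := eqVneq (h (a + t)) (h a).
  by exists 0; rewrite // addn0 mul1n.
have [|c cb eq_c] := IH (a + t).
  by rewrite -ltnS (leq_trans _ hb) // ltn_neqAle ne_h anti ?leq_addr.
by exists c.+1; rewrite // -[in LHS]addnA -mulSn in eq_c; rewrite eq_c -addnA -mulSn.
Qed.

Lemma ltn_sorted_nth s i d : sorted ltn s -> i + d < size s ->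
  nth 0 s i + d <= nth 0 s (i + d).
Proof.
move=> s_lt; elim: d => [|d IH] id_lt; first by rewrite !addn0.
rewrite addnS; apply: leq_ltn_trans (IH _) _; first by rewrite (leq_trans _ id_lt) // addnS.
apply: (sorted_ltn_nth ltn_trans) => //; rewrite ?inE ?addnS //.
by rewrite (leq_trans _ id_lt) // addnS.
Qed.

(** * Bounding the number of bad levels *)

(** If [m] paths end in fewer than [t] vertices, some end point is shared by more than
    [bad_bound t n'] of them. Their total length is at most [m * n'.+2], so one of the next
    [(m * n'.+2).+1] windows of [t] levels shows no drop. The factor [t.+1] keeps the bound monotone
    in [n] even for [t = 0]. *)
Fixpoint bad_bound t n :=
  if n is n'.+1 then
    let m := (t.+1 * bad_bound t n').+1 in m + (m * n'.+2).+1 * t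
  else 1.

Section Levels.
Variables (G : sgraph) (r t K : nat) (P : nat -> {set G}).
Hypothesis PS : forall i, P i \subset P i.+1.
Hypothesis Pfan : forall i (Z F : {set G}), Z \subset P i -> fan r Z F ->
  #|F| <= K -> [disjoint F & P i] ->
  exists2 F', fan r Z F' & F' \subset P i.+1 :\: P i.
Hypothesis noK : ~ shallow_minor r.+1 (complete t) G.

Lemma level_sub i j : i <= j -> P i \subset P j.
Proof.
move/subnKC <-; elim: (j - i) => [|d IH]; first by rewrite addn0.
by rewrite addnS (subset_trans IH).
Qed.

(* By [Pfan], each of the levels [i], ..., [i + t - 1] contributes a fan over
   [Z], and these are disjoint; adding to the [j]-th one the [j]-th vertex of
   [Z] gives the branch sets of a [K_t]. *)
Lemma no_wide_fan i (Z F : {set G}) : Z \subset P i -> fan r Z F -> #|F| <= K ->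
  [disjoint F & P (i + t)] -> #|Z| < t.
Proof.
move=> ZP FZ FK FP; rewrite ltnNge; apply/negP => tZ; apply: noK.
have /fin_all_exists2[F' F'Z F'P] (j : 'I_t) :
    exists2 F', fan r Z F' & F' \subset P (i + j).+1 :\: P (i + j).
  apply: Pfan FZ FK _; first by rewrite (subset_trans ZP) ?level_sub ?leq_addr.
  by apply: disjointWr FP; rewrite level_sub // leq_add2l ltnW.
pose z (j : 'I_t) := enum_val (widen_ord tZ j).
have zZ j : z j \in Z := enum_valP _.
have z_inj : injective z.
  by move=> j j' /enum_val_inj/(congr1 val)/= /val_inj.
have zF j j' : z j \in F' j' = false.
  apply/negP => /(subsetP (F'P _)); rewrite inE => /andP[/negP zP _]; apply: zP.
  by move: (zZ j); apply/subsetP; rewrite (subset_trans ZP) ?level_sub ?leq_addr.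
have FF (j j' : 'I_t) v : v \in F' j -> v \in F' j' -> j <= j'.
  rewrite leqNgt => /(subsetP (F'P _)) vj /(subsetP (F'P _)) vj'; apply/negP => lt.
  move: vj vj'; rewrite !inE => /andP[/negP vj _] /andP[_ vj']; apply: vj.
  by move: vj'; apply/subsetP; rewrite level_sub // ltn_add2l.
apply: (@minor_of_branch_sets _ _ _ (fun j => z j |: F' j)) => [j j' jj'|j|j j' jj'].
- rewrite disjoint_subset; apply/subsetP => v; rewrite !inE => /orP[/eqP->|vj].
    by rewrite (inj_eq z_inj) zF orbF.
  rewrite negb_or; apply/andP; split; first by apply: contraFneq (zF j' j) => <-.
  apply: contra_neqN jj' => vj'; apply: val_inj; apply/eqP.
  by rewrite eqn_leq (FF _ _ v) ?(FF _ _ v vj').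
- have [[c [cF cent]] Fz] := F'Z j; exists c; split; first by rewrite !inE cF orbT.
  move=> v; rewrite !inE => /predU1P[->|/cent[p [cp pv pr sub]]]; last first.
    by exists p; split=> //; [exact: leqW|move=> u /sub; rewrite !inE => ->; rewrite orbT].
  have [u /cent[p [cp pu pr sub]] uz] := Fz _ (zZ j).
  exists (rcons p (z j)); rewrite rcons_path last_rcons size_rcons cp pu uz; split=> // w.
  by rewrite mem_rcons !inE => /predU1P[->|/sub ->]; rewrite ?eqxx ?orbT.
have [_ Fz] := F'Z j; have [u uF uz] := Fz _ (zZ j').
by exists u, (z j'); rewrite !inE uF eqxx orbT.
Qed.

Definition bad n x i := exists p,
  [/\ path (@adj G) x p, size p <= n, last x p \in P i.+1
    & {in x :: p, forall v, v \notin P i}].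

(* Truncate the paths of the first [m] bad levels where they first meet a later
   level [l], chosen so that this place is the same for all of [l], ..., [l + t].
   At least [t] distinct end points would give a wide fan; otherwise one of
   them starts strictly shorter paths to more than [bad_bound t n] levels. *)
Lemma bad_levels_le n x s : n <= r -> bad_bound t n * n.+1 <= K -> sorted ltn s ->
  (forall i, i \in s -> bad n x i) -> size s <= bad_bound t n.
Proof.
elim: n x s => [|n IH] x s nr nK s_lt s_bad.
  (* A path of length 0 puts [x] itself in [P i.+1] but not in [P i], which happens for at most one
     [i]. *)
  case: s s_lt s_bad => [|i [|j s]] //= /andP[ij _] s_bad.
  have [|p [_]] := s_bad i; first exact: mem_head.
  rewrite leqn0 size_eq0 => /eqP-> /= xi _.
  have [|q [_ _ _ /(_ x (mem_head _ _))/negP[]]] := s_bad j; first by rewrite !inE eqxx orbT.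
  by move: xi; apply/subsetP; apply: level_sub.
rewrite leqNgt; apply/negP => big.
pose m := (t.+1 * bad_bound t n).+1; pose M := m * n.+2.
have big' : m + M.+1 * t < size s by [].
have s_m : m < size s by apply: leq_ltn_trans big'; rewrite leq_addr.
pose a := nth 0 s m; pose s1 := take m s.
have s1s i : i \in s1 -> i \in s := @mem_take _ _ _ _.
have s1_size : size s1 = m by rewrite size_take s_m.
have s1_lt i : i \in s1 -> i < a.
  move/(nthP 0)=> [j]; rewrite s1_size => jm <-; rewrite nth_take //.
  by apply: (sorted_ltn_nth ltn_trans) => //; rewrite inE (ltn_trans jm).
(* The entry of [s] at index [m + M.+1 * t] is a bad level, at least [a + M.+1 * t]. *)
have xtop : x \notin P (a + M.+1 * t).
  have [|p [_ _ _ /(_ x (mem_head _ _))]] := s_bad (nth 0 s (m + M.+1 * t)).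
    exact: mem_nth.
  by apply: contra; apply/subsetP; apply: level_sub; apply: ltn_sorted_nth.
have [pi piP] := seq_choice [::] (fun i si => s_bad i (s1s i si)).
(* Where [pi i] first meets [P l]; a larger [l] can only make this earlier. *)
pose f l i := find (mem (P l)) (pi i).
have f_anti i l l' : l <= l' -> f l' i <= f l i.
  by move=> ll'; apply: sub_find => v; apply/subsetP/level_sub.
have [||c cM eq_h] := @antitone_plateau (fun l => \sum_(i <- s1) f l i) t a M.
- by move=> l l' ll'; apply: leq_sum => i _; apply: f_anti.
- rewrite /M -s1_size -sum1_size big_distrl /= big_seq [in leqRHS]big_seq.
  apply: leq_sum => i /piP[_ pn _ _]; rewrite mul1n.
  by apply: leq_trans (find_size _ _) _; apply: leqW.
set l := a + c * t in eq_h; set l' := a + c.+1 * t in eq_h.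
have l'E : l' = l + t by rewrite /l' mulSn addnCA addnC.
have ll' : l <= l' by rewrite l'E leq_addr.
have {eq_h} eq_f i : i \in s1 -> f l i = f l' i.
  move=> si; apply/eqP; rewrite eqn_leq (f_anti _ _ _ ll') andbT -subn_eq0.
  have : \sum_(j <- s1) (f l j - f l' j) == 0.
    by rewrite sumnB ?eq_h ?subnn // => j _; apply: f_anti.
  by rewrite sum_nat_seq_eq0 => /allP/(_ i si).
have xl' : x \notin P l'.
  by apply: contra xtop; apply/subsetP/level_sub; rewrite leq_add2l leq_mul2r ltnS cM orbT.
have xl : x \notin P l by apply: contra xl'; apply/subsetP/level_sub.
(* The part [q i] before the first contact [z i] with [P l] misses even [P l'], since
   [f l i = f l' i]. *)
pose q i := take (f l i) (pi i); pose z i := nth x (pi i) (f l i).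
have f_lt i : i \in s1 -> f l i < size (pi i).
  move=> si; have [_ _ pl _] := piP i si; rewrite -has_find.
  have : last x (pi i) \in P l.
    by move: pl; apply/subsetP/level_sub/(leq_trans (s1_lt i si)); rewrite leq_addr.
  have := mem_last x (pi i); rewrite inE => /predU1P[->|lp Pl]; first by rewrite (negPf xl).
  by apply/hasP; exists (last x (pi i)).
have zP i : i \in s1 -> z i \in P l.
  by move=> si; apply: (@nth_find _ x (mem (P l))); rewrite has_find f_lt.
have pi_split i : i \in s1 -> pi i = q i ++ z i :: drop (f l i).+1 (pi i).
  by move=> si; rewrite -drop_nth ?f_lt // cat_take_drop.
have qP i v : i \in s1 -> v \in x :: q i -> v \notin P l'.
  move=> si; rewrite inE => /predU1P[-> //|/(nthP x)[j]].
  rewrite size_take f_lt // => jf <-; rewrite nth_take //.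
  by rewrite eq_f // in jf; apply/negPf; apply: (before_find x jf).
have q_path i : i \in s1 ->
    [/\ path (@adj G) x (q i), adj (last x (q i)) (z i) & size (q i) <= n].
  move=> si; have [xp pn _ _] := piP i si.
  move: xp pn; rewrite (pi_split i si) cat_path size_cat /= => /and3P[-> -> _] pn.
  by split=> //; rewrite -ltnS (leq_trans _ pn) // addnS ltnS leq_addr.
have z_bad i : i \in s1 -> bad n (z i) i.
  move=> si; have [xp pn pl pP] := piP i si.
  exists (drop (f l i).+1 (pi i)); split.
  - by move: xp; rewrite [in path _ _ _](pi_split i si) cat_path /= => /and3P[].
  - by rewrite size_drop leq_subLR addSn (leq_trans pn) // ltnS leq_addl.
  - by move: pl; rewrite [in last _ _](pi_split i si) last_cat.
  move=> v vp; apply: pP; rewrite inE; apply/orP; right.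
  by rewrite (pi_split i si) mem_cat vp orbT.
pose Z := [set v | v \in map z s1].
pose F := [set v | v \in flatten [seq x :: q i | i <- s1]].
have inF v : reflect (exists2 i, i \in s1 & v \in x :: q i) (v \in F).
  by rewrite inE; apply: flatten_mapP.
have Zt : #|Z| < t.
  apply: (@no_wide_fan l Z F).
  - by apply/subsetP => v; rewrite inE => /mapP[i /zP zi ->].
  - split=> [|v]; last first.
      rewrite inE => /mapP[i si ->]; have [_ qz _] := q_path i si.
      by exists (last x (q i)) => //; apply/inF; exists i => //; apply: mem_last.
    exists x; split.
      by apply/inF; exists (nth 0 s1 0); rewrite ?mem_head ?mem_nth ?s1_size.
    move=> v /inF[i si vq]; have [xq _ qn] := q_path i si.
    have [p1 [p2 [qE pv]]] : exists p1 p2, q i = p1 ++ p2 /\ last x p1 = v.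
      by case/splitPl: vq => p1 p2 pv; exists p1, p2.
    exists p1; split=> //; first by move: xq; rewrite qE cat_path => /andP[].
      by rewrite (leq_trans _ (ltnW nr)) // (leq_trans _ qn) // qE size_cat leq_addr.
    by move=> u up; apply/inF; exists i; rewrite // inE qE mem_cat up orbT.
  - rewrite cardsE (leq_trans (card_size _)) // size_flatten sumnE !big_map.
    rewrite (leq_trans _ nK) // (@leq_trans (m * n.+2)) ?leq_mul2r ?leq_addr ?orbT //.
    rewrite -s1_size -sum1_size big_distrl /= big_seq [in leqRHS]big_seq.
    by apply: leq_sum => i /q_path[_ _ qn]; rewrite mul1n ltnS leqW.
  rewrite -l'E disjoint_subset; apply/subsetP => v /inF[i si vq].
  exact: qP vq.
have [v v_big] : exists v, bad_bound t n < count (fun i => z i == v) s1.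
  apply/existsP; apply: contraT; rewrite negb_exists => /forallP none.
  have : size s1 <= #|Z| * bad_bound t n.
    by apply: pigeonhole_count => v; rewrite leqNgt none.
  by rewrite s1_size leqNgt ltnS leq_mul2r leqW ?orbT // ltnW.
move: v_big; rewrite ltnNge -size_filter => /negP[]; apply: (IH v).
- exact: ltnW.
- rewrite (leq_trans _ nK) // leq_mul // /bad_bound -/bad_bound (leq_trans _ (leq_addr _ _)) //.
  by rewrite mulSn leqW ?leq_addr.
- by apply: sorted_filter; [exact: ltn_trans|exact: take_sorted].
by move=> i; rewrite mem_filter => /andP[/eqP <-]; apply: z_bad.
Qed.

End Levels.

(** * One step of the chain *)

Lemma leq_card_bigcup (I T : finType) (A : {set I}) (F : I -> {set T}) b :
  (forall i, i \in A -> #|F i| <= b) -> #|\bigcup_(i in A) F i| <= #|A| * b.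
Proof.
move=> Fb; rewrite -sum_nat_const.
apply: (@leq_trans (\sum_(i in A) #|F i|)); last exact: leq_sum.
elim/big_rec2: _ => [|i n B _ IH]; first by rewrite cards0.
by apply: leq_trans (leq_card_setU _ _) _; rewrite leq_add2l.
Qed.

(* The three summands account for [Q], for the fans over its subsets, and for
   the types of [k]-tuples over [Q]. *)
Definition step_bound k r K q := q + 2 ^ q * K + 2 ^ (k * r.+1 * q) * k.

Lemma step_bound_mono k r K : {homo step_bound k r K : q q' / q <= q'}.
Proof. by move=> q q' qq'; rewrite !leq_add // leq_mul // leq_pexp2l // leq_mul. Qed.

Lemma closure_step (G : sgraph) k r K (Q : {set G}) : exists Q' : {set G},
  [/\ Q \subset Q', #|Q'| <= step_bound k r K #|Q|,
      forall Z F : {set G}, Z \subset Q -> fan r Z F -> #|F| <= K ->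
        [disjoint F & Q] -> exists2 F', fan r Z F' & F' \subset Q' :\: Q
    & forall x : k.-tuple G, exists y : k.-tuple G, forall j,
        tnth y j \in Q' /\
        {in Q, forall v d, d <= r -> within d (tnth y j) v = within d (tnth x j) v}].
Proof.
(* One small fan outside [Q] is fixed for each [Z]; the empty set is the default if there is
   none. *)
have /fin_all_exists[W WP] (Z : {set G}) : exists W : {set G}, #|W| <= K /\
    ((exists F, [/\ fan r Z F, #|F| <= K & [disjoint F & Q]]) ->
     fan r Z W /\ [disjoint W & Q]).
  have [[F [FZ FK FQ]]|none] := classic (exists F, [/\ fan r Z F, #|F| <= K & [disjoint F & Q]]).
    by exists F.
  by exists set0; rewrite cards0; split=> // /none.
(* The type of [x] over [Q]: all distances up to [r] from its entries to [Q]. Each realized type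
   gets one representative. *)
pose tau (x : k.-tuple G) :=
  [set u : 'I_k * 'I_r.+1 * G | (u.2 \in Q) && within u.1.2 (tnth x u.1.1) u.2].
pose rep U := [pick x | tau x == U].
pose coords U := if rep U is Some x then [set tnth x j | j : 'I_k] else set0.
pose D := setX [set: 'I_k * 'I_r.+1] Q.
exists (Q :|: \bigcup_(Z in powerset Q) W Z :|: \bigcup_(U in powerset D) coords U); split.
- by rewrite -setUA subsetUl.
- apply: leq_trans (leq_card_setU _ _) _; apply: leq_add.
    apply: leq_trans (leq_card_setU _ _) _; rewrite leq_add2l -card_powerset.
    by apply: leq_card_bigcup => Z _; case: (WP Z).
  have <- : #|powerset D| = 2 ^ (k * r.+1 * #|Q|).
    by rewrite card_powerset cardsX cardsT card_prod !card_ord.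
  apply: leq_card_bigcup => U _; rewrite /coords; case: (rep U) => [x|]; last by rewrite cards0.
  by rewrite (leq_trans (leq_imset_card _ _)) // card_ord.
- move=> Z F ZQ FZ FK FQ; have [_ [|WZ WQ]] := WP Z; first by exists F.
  exists (W Z) => //; rewrite subsetD WQ andbT; apply/subsetP => v vW.
  by rewrite !inE; apply/orP; left; apply/orP; right; apply/bigcupP; exists Z; rewrite ?powersetE.
move=> x; have [y repy] : exists y, rep (tau x) = Some y.
  by rewrite /rep; case: pickP => [y _|/(_ x)]; [exists y|rewrite eqxx].
have yx : tau y = tau x.
  by move: repy; rewrite /rep; case: pickP => // _ /eqP <- [->].
exists y => j; split.
  rewrite !inE; apply/orP; right; apply/bigcupP; exists (tau x).
    by rewrite powersetE; apply/subsetP => u; rewrite !inE => /andP[].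
  by rewrite /coords repy imset_f.
move=> v vQ d dr; have /setP/(_ (j, Ordinal (dr : d < r.+1), v)) := yx.
by rewrite !inE vQ.
Qed.

(** * Good levels and the diagonal tuple *)

Theorem theorem12 (C : graph_class) (hC : nowhere_dense C) (k r : nat) :
  exists p : nat, class_weak_helly p (eta_class k r C).
Proof.
have [t noK] := hC r.+1; pose g := bad_bound t r; pose K := g * r.+1.
(* Each of the [k] entries has at most [g] bad levels below [L], so [k] levels remain that are good
   for all. *)
pose L := k * g + k; exists (iter L (step_bound k r K) 0) => _ [G CG ->].
have {}noK := noK G CG.
have /fin_all_exists[step stepP] := @closure_step G k r K.
pose P i := iter i step set0.
have PS i : P i \subset P i.+1 by have [] := stepP (P i).
have P_card i : #|P i| <= iter i (step_bound k r K) 0.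
  elim: i => [|i IH]; first by rewrite cards0.
  by have [_ le _ _] := stepP (P i); apply: (leq_trans le); apply: step_bound_mono.
have Pfan i (Z F : {set G}) : Z \subset P i -> fan r Z F -> #|F| <= K ->
    [disjoint F & P i] -> exists2 F', fan r Z F' & F' \subset P i.+1 :\: P i.
  by have [_ _ + _] := stepP (P i); apply.
have Psub := level_sub PS.
have [|none] := boolP [exists x, [forall b, (b \in P L) ==> @eta k r G x b]]; last first.
  right; exists (P L); split=> // -[x xP]; case/existsP: none; exists x.
  by apply/forallP => b; apply/implyP; apply: xP.
case/existsP => x /forallP xP; left.
have /fin_all_exists[isbad isbadP] (j : 'I_k) : exists isbad : nat -> bool,
    forall i, i \in iota 0 L -> (isbad i <-> bad P r (tnth x j) i).
  apply: (seq_choice (Q := fun i (b : bool) => b <-> bad P r (tnth x j) i) true) => i _.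
  by case: (classic (bad P r (tnth x j) i)); [exists true|exists false].
pose s := [seq i <- iota 0 L | [forall j, ~~ isbad j i]].
have s_lt : sorted ltn s by apply: sorted_filter (iota_ltn_sorted _ _); apply: ltn_trans.
have s_size : k <= size s.
  have : count (fun i => [exists j, isbad j i]) (iota 0 L) <= k * g.
    rewrite -[k in _ <= k * _]card_ord -sum_nat_const.
    have : \sum_(j < k) count (isbad j) (iota 0 L) <= \sum_(j < k) g.
      apply: leq_sum => j _; rewrite -size_filter.
      apply: (bad_levels_le PS Pfan noK (x := tnth x j)) => //.
        by apply: sorted_filter (iota_ltn_sorted _ _); apply: ltn_trans.
      by move=> i; rewrite mem_filter => /andP[bi iL]; apply/isbadP.
    apply: leq_trans; under eq_bigr => j _ do rewrite -sum1_count big_mkcond /=.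
    rewrite exchange_big -sum1_count big_mkcond /=; apply: leq_sum => i _.
    by case: existsP => // -[j ji]; rewrite (bigD1 j) //= ji.
  have := count_predC (fun i => [exists j, isbad j i]) (iota 0 L).
  rewrite size_iota => LE le; rewrite size_filter -(leq_add2l (k * g)) -/L -[leqLHS]LE.
  apply: leq_add => //; rewrite leq_eqVlt; apply/orP; left; apply/eqP.
  by apply: eq_count => i /=; rewrite negb_exists.
pose lv (j : 'I_k) := nth 0 s j.
have lv_in j : lv j \in s by rewrite mem_nth // (leq_trans _ s_size).
have lv_L j : lv j < L by have := lv_in j; rewrite mem_filter mem_iota => /and3P[].
have lv_good j i : ~ bad P r (tnth x j) (lv i).
  have := lv_in i; rewrite mem_filter => /andP[/forallP/(_ j)/negP nb sL].
  by move/isbadP => /(_ sL).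
have lv_mono (i j : 'I_k) : i < j -> lv i < lv j.
  by move=> ij; apply: (sorted_ltn_nth ltn_trans) => //; rewrite inE (leq_trans _ s_size).
have /fin_all_exists[y yP] (j : 'I_k) : exists y : k.-tuple G, forall i,
    tnth y i \in P (lv j).+1 /\
    {in P (lv j), forall v d, d <= r -> within d (tnth y i) v = within d (tnth x i) v}.
  by have [_ _ _] := stepP (P (lv j)); apply.
exists [tuple tnth (y j) j | j < k] => b; apply: contraT => /etaPn[i [j [d ij [dr]]]].
rewrite !tnth_mktuple => yib yjb.
have [yiP yi] := yP i i; have [_ yj] := yP j j.
have : within r (tnth (y j) j) (tnth (y i) i).
  by rewrite -(subnK dr); apply: within_trans yjb _; rewrite within_sym.
(* As [i < j], the vertex [tnth (y i) i] lies in [P (lv j)], over which [y j] and [x] have the same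
   type. *)
rewrite yj //; last by move: yiP; apply/subsetP/Psub/lv_mono.
(* This path makes [lv i] bad for the [j]-th entry of [x] once it is shown to avoid [P (lv i)]. *)
case/withinP=> p [xp pyi pr]; case: (lv_good j i); exists p; split=> //; first by rewrite pyi.
move=> v vp; apply/negP => vP.
have vL : v \in P L by move: vP; apply/subsetP/Psub/ltnW.
(* Splitting the path at [v] links [v] to the [j]-th entry of [x] and, since [y i] and [x] have the
   same type over [P (lv i)], to the [i]-th, with total length at most [r]. *)
have := xP v; rewrite vL; apply/negP/etaPn.
case/splitPl: vp xp pyi pr => p1 p2 p1v; rewrite cat_path last_cat size_cat p1v.
case/andP=> xp1 vp2 p2y pr; exists i, j, (size p2) => //.
have p2r : size p2 <= r by apply: leq_trans pr; rewrite leq_addl.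
have p1r : size p1 <= r - size p2 by rewrite leq_subRL // addnC.
split; [exact: p2r | | by apply/withinP; exists p1].
by rewrite -(yi v vP) // within_sym; apply/withinP; exists p2.
Qed.
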